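(* For each $d\ge 2$ and each $\mu\in(0,1]$ there exist $\delta>0$ and $\beta_*=\beta_*(\mu,d,\delta)>0$ such that for every $\beta\in[0,1]$ with $\beta<\beta_*$, the ERWD $(\omega_n)_{n\ge0}$ on $\mathbb{Z}^d$ with parameters $\beta,\mu$ satisfies $$\mathbb{Q}\Big(\limsup_{n\to\infty}\frac{\omega_n^{[1]}}{n}<-\delta\Big)=1.$$
   Context: Let $e_1=(1,0,\dots,0)\in\mathbb{Z}^d$, and let $x^{[1]}$ denote the first component of $x\in\mathbb{Z}^d$. For $\beta,\mu\in[0,1]$, the ERWD (excited random walk with opposing drift) on $\mathbb{Z}^d$ with parameters $\beta,\mu$ is the nearest-neighbour random process $(\omega_n)_{n\ge 0}$ with $\omega_0=0$ and law $\mathbb{Q}=\mathbb{Q}_{d,\beta,\mu}$ determined by the following: given the history $\omega_0=\eta_0,\dots,\omega_i=\eta_i$, the conditional probability of stepping to $\eta_i+x$, for each unit vector $x$ (nearest neighbour of the origin), is $$\frac{1+(e_1\cdot x)\,\beta}{2d}\ \text{ if }\eta_i\notin\{\eta_0,\dots,\eta_{i-1}\},\qquad \frac{1-(e_1\cdot x)\,\mu}{2d}\ \text{ if }\eta_i\in\{\eta_0,\dots,\eta_{i-1}\}.$$ In particular the first step has probabilities $(2d)^{-1}(1+\beta\, e_1\cdot x)$. *)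

(* Defs.v *)
From HB Require Import structures.
From mathcomp Require Import all_boot all_order all_algebra.
From mathcomp Require Import all_classical all_reals all_analysis.

Set Implicit Arguments.
Unset Strict Implicit.
Unset Printing Implicit Defensive.

Import Order.TTheory GRing.Theory Num.Theory.
Local Open Scope classical_set_scope.
Local Open Scope ring_scope.

Definition dotZ (d : nat) (x y : 'rV[int]_d) : int :=
  \sum_(j < d) x ord0 j * y ord0 j.

(* Coordinates are numbered from 0, so the first one has index 0. *)
Definition e1 (d : nat) : 'rV[int]_d := \row_(j < d) (nat_of_ord j == 0%N)%:R.

(* For integer vectors, x . x = 1 exactly for the 2d vectors +e_j, -e_j. *)
Definition unit_vec (d : nat) (x : 'rV[int]_d) : bool := dotZ x x == 1.

Definition visited_before (d : nat) (eta : nat -> 'rV[int]_d) (i : nat) : bool :=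
  [exists j : 'I_i, eta j == eta i].

Definition step_prob (R : realType) (d : nat) (beta mu : R)
    (eta : nat -> 'rV[int]_d) (i : nat) (x : 'rV[int]_d) : R :=
  if visited_before eta i
  then (1 - (dotZ (e1 d) x)%:~R * mu) / (2 * d)%:R
  else (1 + (dotZ (e1 d) x)%:~R * beta) / (2 * d)%:R.

Definition history (d : nat) (T : Type) (omega : nat -> T -> 'rV[int]_d)
    (eta : nat -> 'rV[int]_d) (i : nat) : set T :=
  [set t | forall j : nat, (j <= i)%N -> omega j t = eta j].

(* Meaningful only when P B != 0. *)
Definition cond_prob (disp : measure_display) (T : measurableType disp)
    (R : realType) (P : probability T R) (A B : set T) : R :=
  fine (P (A `&` B)) / fine (P B).

(* [omega], a process on an arbitrary probability space, has the law Q of the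
   ERWD: apart from measurability, the clauses constrain only the law.  Measurability is
   with respect to the discrete sigma-algebra on the countable set Z^d. *)
Record is_ERWD (disp : measure_display) (T : measurableType disp)
    (R : realType) (P : probability T R) (d : nat) (beta mu : R)
    (omega : nat -> T -> 'rV[int]_d) : Prop := {
  ERWD_measurable : forall (n : nat) (x : 'rV[int]_d),
    measurable [set t | omega n t = x];
  ERWD_start : P [set t | omega 0%N t = 0] = 1%E;
  ERWD_nearest_neighbour : forall n : nat,
    P [set t | unit_vec (omega n.+1 t - omega n t)] = 1%E;
  ERWD_step : forall (eta : nat -> 'rV[int]_d) (i : nat) (x : 'rV[int]_d),
    unit_vec x -> P (history omega eta i) != 0%E ->
    cond_prob P [set t | omega i.+1 t = eta i + x] (history omega eta i)
    = step_prob beta mu eta i x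
}.

(* Main.v *)
Require Import Defs.
From HB Require Import structures.
From mathcomp Require Import all_boot all_order all_algebra.
From mathcomp Require Import all_classical all_reals all_analysis.
From mathcomp Require Import measurable_realfun.
From mathcomp Require Import ring lra.

Set Implicit Arguments.
Unset Strict Implicit.
Unset Printing Implicit Defensive.

Import Order.TTheory GRing.Theory Num.Theory.
Local Open Scope classical_set_scope.
Local Open Scope ring_scope.

(** From a new site the walk steps back to its previous, hence visited, position
    with probability at least [1/(4d)], and at a visited site it has drift [-mu/d];
    so for small [beta] it drifts to the left.  Quantitatively, with [X] the first
    coordinate of the current position, the potential
    [exp (theta X) (1 + kappa 1[current site is new])] contracts in conditional mean
    by a factor [rho < 1] at every step but the first.  Hence
    [P (X_n >= - 2 delta n)] decays geometrically, and Borel-Cantelli concludes. *)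

(** * A quadratic bound for the exponential *)

(** From [1 - t <= expR (- t)] one gets [expR t * (1 - t) <= 1], while [(1 + t + 2 t^2) (1 - t) = 1
    + t^2 (1 - 2 t)] is at least 1 for [t <= 1/2]. *)
Lemma expR_le_quad (R : realType) (t : R) :
  t <= 2^-1 -> expR t <= 1 + t + 2 * t ^+ 2.
Proof.
move=> ht; have := expR_ge1Dx (- t); rewrite expRN => h.
have e0 := expR_gt0 t; have : expR t * (1 - t) <= 1.
  by rewrite -[leRHS](mulfV (lt0r_neq0 e0)) ler_pM2l.
by move: (expR t) e0 => e {h}; nra.
Qed.

(** * Unit vectors and the exponential moment of one step *)

Definition coord0 (d : nat) (hd : (0 < d)%N) (x : 'rV[int]_d) : int :=
  x ord0 (Ordinal hd).

Lemma dotZ_e1 (d : nat) (hd : (0 < d)%N) (x : 'rV[int]_d) :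
  dotZ (e1 d) x = coord0 hd x.
Proof.
rewrite /dotZ /coord0 (bigD1 (Ordinal hd))//= mxE eqxx mul1r big1 ?addr0//.
by move=> j; rewrite -val_eqE /= mxE => /negPf ->; rewrite mul0r.
Qed.

(* The direction [(j, b)] stands for the unit vector (-1)^b e_j. *)
Definition dir (d : nat) : finType := ('I_d * bool)%type.

Definition vec (d : nat) (a : dir d) : 'rV[int]_d :=
  (-1) ^+ nat_of_bool a.2 *: delta_mx ord0 a.1.

Lemma vec_opp (d : nat) (a : dir d) : vec (a.1, ~~ a.2) = - vec a.
Proof. by case: a => j [] /=; rewrite /vec /= expr0 expr1 !scaleN1r !scale1r ?opprK. Qed.

Lemma unit_vec_vec (d : nat) (a : dir d) : unit_vec (vec a).
Proof.
rewrite /unit_vec /dotZ (bigD1 a.1)//= big1 => [|j ja].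
  by rewrite /vec !mxE !eqxx /= mulr1 addr0; case: a.2.
by rewrite /vec !mxE (negPf ja) /= mulr0 mul0r.
Qed.

(** A nonzero integer coordinate has square at least 1, so it uses up the whole norm and the other
    coordinates vanish. *)
Lemma unit_vecP (d : nat) (x : 'rV[int]_d) : unit_vec x -> exists a, x = vec a.
Proof.
rewrite /unit_vec => /eqP xx.
have [j xj0] : exists j, x ord0 j != 0.
  apply/existsP; rewrite -[X in is_true X]negbK negb_exists; apply/negP => /forallP h.
  move: xx; rewrite /dotZ big1// => j _.
  by have := h j; rewrite negbK => /eqP ->; rewrite mul0r.
have rest0 : 0 <= \sum_(i < d | i != j) x ord0 i * x ord0 i.
  by apply: sumr_ge0 => i _; rewrite -expr2 sqr_ge0.
move: xx; rewrite /dotZ (bigD1 j)//= => xx.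
have xj1 : 1 <= x ord0 j * x ord0 j.
  by rewrite -gtz0_ge1 -expr2 exprn_even_gt0.
have xj : x ord0 j * x ord0 j = 1 by apply/eqP; rewrite eq_le xj1 andbT -xx lerDl.
have restE : \sum_(i < d | i != j) x ord0 i * x ord0 i = 0.
  by apply: (@addrI _ 1); rewrite addr0 -[in LHS]xj xx.
have xi0 i : i != j -> x ord0 i = 0.
  move=> ij; move/eqP: restE; rewrite psumr_eq0 => [/allP/(_ i)|k _].
    by rewrite mem_index_enum => /(_ isT) /implyP/(_ ij); rewrite mulf_eq0 orbb => /eqP.
  by rewrite -expr2 sqr_ge0.
move/eqP: xj; rewrite -expr2 sqrf_eq1 => /orP[] /eqP xj.
- exists (j, false); apply/rowP => i; rewrite /vec !mxE /= expr0 mul1r.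
  by case: eqVneq => [->|/xi0].
- exists (j, true); apply/rowP => i; rewrite /vec !mxE /= expr1.
  by case: eqVneq => [->|/xi0 ->]; rewrite ?mulr1 ?mulr0.
Qed.

Definition dx (R : realType) (d : nat) (hd : (0 < d)%N) (a : dir d) : R :=
  (coord0 hd (vec a))%:~R.

Lemma dxE (R : realType) (d : nat) (hd : (0 < d)%N) (a : dir d) :
  dx R hd a = (-1) ^+ nat_of_bool a.2 * (a.1 == Ordinal hd)%:R.
Proof.
by rewrite /dx /coord0 /vec !mxE /= eq_sym; case: a => j []; case: eqP => _ /=;
   rewrite ?expr0 ?expr1 ?mulr0 ?mulr1.
Qed.

Lemma dx_cases (R : realType) (d : nat) (hd : (0 < d)%N) (a : dir d) :
  [\/ dx R hd a = -1, dx R hd a = 0 | dx R hd a = 1].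
Proof.
rewrite dxE; case: a => j []; case: eqP => _ /=;
  rewrite ?expr0 ?expr1 ?mulr0 ?mulr1; by [apply: Or31|apply: Or32|apply: Or33].
Qed.

(** Here [gamma] is the bias along [e1]: [beta] at a new site, [- mu] at a visited one. Once each
    exponential is replaced by its quadratic bound, the sum equals the right-hand side exactly: only
    the two directions along the first axis contribute more than their probability. *)
Lemma sum_drift_expR (R : realType) (d : nat) (hd : (0 < d)%N) (gamma theta : R) :
  -1 <= gamma -> gamma <= 1 -> 0 <= theta -> theta <= 2^-1 ->
  \sum_(a : dir d) (1 + dx R hd a * gamma) / (2 * d)%:R * expR (theta * dx R hd a)
  <= 1 + (gamma * theta + 2 * theta ^+ 2) / d%:R.
Proof.
move=> g0 g1 t0 t1.
have d0 : 0 < d%:R :> R by rewrite ltr0n.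
have d20 : 0 < (2 * d)%:R :> R by rewrite ltr0n muln_gt0.
pose q a : R := (1 + dx R hd a * gamma) / (2 * d)%:R *
  (1 + theta * dx R hd a + 2 * (theta * dx R hd a) ^+ 2).
apply: (@le_trans _ _ (\sum_(a : dir d) q a)).
  apply: ler_sum => a _; rewrite /q ler_wpM2l//.
    by rewrite divr_ge0 ?(ltW d20)//; case: (dx_cases R hd a) => ->; lra.
  by apply: expR_le_quad; case: (dx_cases R hd a) => ->; lra.
rewrite -(pair_bigA _ (fun i j => q (i, j)))/=.
rewrite (bigD1 (Ordinal hd))//= [X in _ + X](eq_bigr (fun=> 2 / (2 * d)%:R)) => [|j jd].
  rewrite big_bool /q !dxE /= expr1 expr0 !mulr1 sumr_const cardC1 card_ord.
  rewrite -(mulr_natl (2 / (2 * d)%:R)) -subn1 natrB // natrM le_eqVlt; apply/orP; left; apply/eqP.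
  by field; rewrite lt0r_neq0.
by rewrite big_bool /q !dxE /= (negPf jd) !mulr0 !mul0r !addr0 expr0n /= mulr0 addr0 mulr1 -mulrDl.
Qed.

(** * The potential and its contraction in mean *)

(** Paths are total functions of which only the values up to the current time matter; after time
    [i.+1] the value is a filler. *)
Definition ext (d : nat) (eta : nat -> 'rV[int]_d) (i : nat) (x : 'rV[int]_d)
    (j : nat) : 'rV[int]_d :=
  if (j <= i)%N then eta j else eta i + x.

Lemma ext_last (d : nat) (eta : nat -> 'rV[int]_d) (i : nat) (x : 'rV[int]_d) :
  ext eta i x i.+1 = eta i + x.
Proof. by rewrite /ext ltnn. Qed.

Lemma ext_init (d : nat) (eta : nat -> 'rV[int]_d) (i j : nat) (x : 'rV[int]_d) :
  (j <= i)%N -> ext eta i x j = eta j.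
Proof. by rewrite /ext => ->. Qed.

(** The surcharge [kappa] at a new site is lost again when the walk steps onto a visited one; this
    loss compensates the possible drift to the right at new sites. *)
Definition potential (R : realType) (d : nat) (hd : (0 < d)%N) (theta kappa : R)
    (eta : nat -> 'rV[int]_d) (i : nat) : R :=
  expR (theta * (coord0 hd (eta i))%:~R) *
  (1 + if visited_before eta i then 0 else kappa).

Lemma potential_le (R : realType) (d : nat) (hd : (0 < d)%N) (theta kappa : R)
    (eta : nat -> 'rV[int]_d) (i : nat) : 0 <= kappa ->
  potential hd theta kappa eta i <=
  expR (theta * (coord0 hd (eta i))%:~R) * (1 + kappa).
Proof. by move=> k0; rewrite ler_wpM2l ?expR_ge0//; case: ifP => _; rewrite lerD2l. Qed.

Lemma le_potential (R : realType) (d : nat) (hd : (0 < d)%N) (theta kappa : R)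
    (eta : nat -> 'rV[int]_d) (i : nat) : 0 <= kappa ->
  expR (theta * (coord0 hd (eta i))%:~R) <= potential hd theta kappa eta i.
Proof.
by move=> k0; rewrite /potential ler_peMr ?expR_ge0//; case: ifP => _; lra.
Qed.

Lemma potential_ge0 (R : realType) (d : nat) (hd : (0 < d)%N) (theta kappa : R)
    (eta : nat -> 'rV[int]_d) (i : nat) : 0 <= kappa ->
  0 <= potential hd theta kappa eta i.
Proof. by move=> k0; apply: le_trans (expR_ge0 _) (le_potential _ _ _ _ k0). Qed.

Lemma step_prob_vec (R : realType) (d : nat) (hd : (0 < d)%N) (beta mu : R)
    (eta : nat -> 'rV[int]_d) (i : nat) (a : dir d) :
  step_prob beta mu eta i (vec a) =
  (1 + dx R hd a * (if visited_before eta i then - mu else beta)) / (2 * d)%:R.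
Proof. by rewrite /step_prob dotZ_e1; case: ifP; rewrite ?mulrN. Qed.

Lemma step_prob_ge0 (R : realType) (d : nat) (hd : (0 < d)%N) (beta mu : R)
    (eta : nat -> 'rV[int]_d) (i : nat) (a : dir d) :
  0 <= beta -> beta <= 1 -> 0 <= mu -> mu <= 1 ->
  0 <= step_prob beta mu eta i (vec a).
Proof.
move=> b0 b1 m0 m1; rewrite (step_prob_vec hd) divr_ge0//.
by case: (dx_cases R hd a) => ->; case: ifP => _; lra.
Qed.

Lemma coord0_ext (R : realType) (d : nat) (hd : (0 < d)%N)
    (eta : nat -> 'rV[int]_d) (i : nat) (a : dir d) :
  (coord0 hd (ext eta i (vec a) i.+1))%:~R =
  (coord0 hd (eta i))%:~R + dx R hd a.
Proof. by rewrite ext_last /coord0 /dx mxE intrD. Qed.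

Lemma visited_before_ext (d : nat) (eta : nat -> 'rV[int]_d) (i : nat) (x : 'rV[int]_d) :
  eta i.+1 + x = eta i -> visited_before (ext eta i.+1 x) i.+2.
Proof.
move=> back; apply/existsP; exists (inord i); rewrite inordK//.
by rewrite ext_last ext_init// back.
Qed.

(* The two last hypotheses are the conditions for the potential to contract in
   mean by [rho] at a visited, respectively at a new, site; the loss [kappa / 8d]
   is due to the possibility of stepping back from a new site. *)
Lemma potential_step (R : realType) (d : nat) (hd : (0 < d)%N)
    (beta mu theta kappa rho : R) (eta : nat -> 'rV[int]_d) (i : nat) :
  0 <= beta -> beta <= 2^-1 -> 0 <= mu -> mu <= 1 ->
  0 <= theta -> theta <= 2^-1 -> 0 <= kappa ->
  (1 + kappa) * (1 + (- mu * theta + 2 * theta ^+ 2) / d%:R) <= rho ->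
  (1 + kappa) * (1 + (beta * theta + 2 * theta ^+ 2) / d%:R) - kappa * (d%:R^-1 / 8)
    <= rho * (1 + kappa) ->
  unit_vec (eta i.+1 - eta i) ->
  \sum_(a : dir d) step_prob beta mu eta i.+1 (vec a) *
     potential hd theta kappa (ext eta i.+1 (vec a)) i.+2
  <= rho * potential hd theta kappa eta i.+1.
Proof.
move=> b0 b1 m0 m1 t0 t1 k0 hvis hnew step.
set X : R := (coord0 hd (eta i.+1))%:~R.
set gamma := if visited_before eta i.+1 then - mu else beta.
have g1 : -1 <= gamma by rewrite /gamma; case: ifP; lra.
have g2 : gamma <= 1 by rewrite /gamma; case: ifP; lra.
(* [a0] is the direction back to the previous position, hence to a visited site. *)
have [a0 back] : exists a, eta i.+1 + vec a = eta i.
  have [a ha] := unit_vecP step; exists (a.1, ~~ a.2).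
  by rewrite vec_opp -ha opprB addrC subrK.
pose w a : R := (1 + dx R hd a * gamma) / (2 * d)%:R * expR (theta * dx R hd a).
have sumE : \sum_a w a <= 1 + (gamma * theta + 2 * theta ^+ 2) / d%:R.
  exact: sum_drift_expR g1 g2 t0 t1.
have w0 a : 0 <= w a.
  rewrite mulr_ge0 ?expR_ge0// divr_ge0//.
  by case: (dx_cases R hd a) => ->; lra.
have termE a : step_prob beta mu eta i.+1 (vec a) *
     potential hd theta kappa (ext eta i.+1 (vec a)) i.+2 =
   expR (theta * X) * (w a *
     (1 + if visited_before (ext eta i.+1 (vec a)) i.+2 then 0 else kappa)).
  rewrite (step_prob_vec hd) /potential (coord0_ext R) [theta * (_ + _)]mulrDr expRD.
  by rewrite /w -/gamma -/X; ring.
under eq_bigr do rewrite termE.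
rewrite -mulr_sumr /potential -/X [leRHS]mulrCA ler_pM2l ?expR_gt0//.
have k1 : 0 <= 1 + kappa by rewrite addr_ge0.
(* Crude bound: every next site is charged as if it were new. *)
have le_w a : w a *
    (1 + if visited_before (ext eta i.+1 (vec a)) i.+2 then 0 else kappa)
  <= (1 + kappa) * w a.
  by rewrite mulrC ler_wpM2r// lerD2l; case: ifP.
have [vis|new] := boolP (visited_before eta i.+1).
  have gE : gamma = - mu by rewrite /gamma vis.
  rewrite addr0 mulr1; apply: le_trans hvis.
  apply: (@le_trans _ _ ((1 + kappa) * \sum_a w a)).
    by rewrite mulr_sumr; apply: ler_sum.
  by rewrite -gE ler_wpM2l.
have gE : gamma = beta by rewrite /gamma (negPf new).
apply: le_trans hnew.
(* Along [a0] the surcharge is certainly not paid, which improves the crude bound by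
   [kappa * w a0]. *)
apply: (@le_trans _ _ ((1 + kappa) * (\sum_a w a) - kappa * w a0)).
  rewrite (bigD1 a0)//= visited_before_ext// addr0 mulr1.
  rewrite [in leRHS](bigD1 a0)//= mulrDr [(1 + kappa) * w a0]mulrDl mul1r.
  rewrite [leRHS](_ : _ = w a0 + (1 + kappa) * \sum_(a | a != a0) w a); last by ring.
  by rewrite lerD2l mulr_sumr; apply: ler_sum.
apply: lerB; first by rewrite -gE ler_wpM2l.
(* It remains to see that [w a0] is at least [1/(8d)]: the step back has probability at least
   [1/(4d)] because [beta <= 1/2], and its exponential factor is at least [1 - theta >= 1/2]. *)
rewrite ler_wpM2l// /w gE natrM invfM.
have u0 : 0 <= d%:R^-1 :> R by rewrite invr_ge0.
move: (d%:R^-1) u0 => u u0.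
have e1 : 2^-1 <= expR (theta * dx R hd a0).
  by apply: le_trans (expR_ge1Dx _); case: (dx_cases R hd a0) => ->; lra.
have p1 : u / 4 <= (1 + dx R hd a0 * beta) * (2^-1 * u).
  have ub0 : 0 <= beta * u by rewrite mulr_ge0.
  have ub1 : beta * u <= 2^-1 * u by rewrite ler_wpM2r.
  by case: (dx_cases R hd a0) => ->; lra.
rewrite (_ : u / 8 = u / 4 * 2^-1); last by lra.
by rewrite ler_pM// divr_ge0.
Qed.

(** Here [u] stands for [1/d]. Put [s = theta mu u] and [q = theta^2 u], so that [kappa = s/2],
    [rho = 1 - 4 q] and [256 q <= s u <= s]. At a visited site the drift gains [s], of which [kappa]
    costs only half. At a new site [beta theta u <= 2 q], so [8 q (1 + kappa) <= s u / 16]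
    suffices. *)
Lemma contraction_constants (R : realType) (mu beta theta u : R) :
  0 < mu -> mu <= 1 -> 0 < u -> u <= 1 -> 0 < theta ->
  16 * (16 * theta) <= mu * u -> beta <= 2 * theta ->
  let kappa := theta * mu * u / 2 in
  let rho := 1 - 4 * theta ^+ 2 * u in
  [/\ theta <= 32^-1, kappa <= 1,
   (1 + kappa) * (1 + (- mu * theta + 2 * theta ^+ 2) * u) <= rho &
   (1 + kappa) * (1 + (beta * theta + 2 * theta ^+ 2) * u) - kappa * (u / 8)
    <= rho * (1 + kappa)].
Proof.
move=> m0 m1 u0 u1 t0 t256 bt /=.
have mu1 : mu * u <= 1 by rewrite mulr_ile1// ltW.
have t32 : theta <= 32^-1 by lra.
pose s := theta * mu * u; pose q := theta ^+ 2 * u.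
have s0 : 0 <= s by rewrite /s !mulr_ge0// ltW.
have q0 : 0 <= q by rewrite /q mulr_ge0 ?sqr_ge0// ltW.
have s1 : s <= 1.
  rewrite /s -mulrA mulr_ile1 ?mulr_ge0// ?(ltW m0) ?(ltW u0) ?(ltW t0)//.
  by lra.
have tt : 16 * (16 * theta ^+ 2) <= s.
  have := ler_wpM2l (ltW t0) t256; rewrite /s; lra.
have q_le : 16 * (16 * q) <= s * u.
  have := ler_wpM2r (ltW u0) tt; rewrite /q; lra.
have su : s * u <= s by rewrite ler_piMr.
have sq : s * q <= q by rewrite ler_piMl.
have btu : beta * theta * u <= 2 * q.
  have := ler_wpM2r (mulr_ge0 (ltW t0) (ltW u0)) bt; rewrite /q; lra.
(* With the products bounded separately, both inequalities become linear in the monomials. *)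
have ss : 0 <= s * s by rewrite mulr_ge0.
have sb : s * (beta * theta * u) <= s * (2 * q) by rewrite ler_wpM2l.
have hvis : (- mu * theta + 2 * theta ^+ 2) * u = - s + 2 * q by rewrite /s /q; ring.
have hnew : (beta * theta + 2 * theta ^+ 2) * u = beta * theta * u + 2 * q.
  by rewrite /q; ring.
rewrite hvis hnew -/s -[4 * _ * u]mulrA -/q.
move: s q (beta * theta * u) s0 q0 s1 q_le su sq ss btu sb {tt hvis hnew}.
by move=> s q b *; split; lra.
Qed.

(** * Measurability for countable targets, and the union bound *)

Lemma measurable_countable_preimage (disp : measure_display)
    (T : measurableType disp) (C : countType) (f : T -> C) (A : set C) :
  (forall x, measurable [set t | f t = x]) -> measurable [set t | A (f t)].
Proof.
move=> mf.
pose F k := if @unpickle C k is Some x then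
  if `[< A x >] then [set t | f t = x] else set0 else set0.
rewrite (_ : [set _ | _] = \bigcup_k F k).
  apply: bigcup_measurable => k _; rewrite /F.
  by case: unpickle => // x; case: ifP.
apply/seteqP; split => [t At|t [k _]] /=.
  by exists (pickle (f t)) => //; rewrite /F pickleK asboolT.
by rewrite /F; case: unpickle => // x; case: asboolP => // Ax /= ->.
Qed.

(** Union bound up to a null set [N], for real-valued probabilities; the induction cuts [A] along
    one [F i] at a time. *)
Lemma fine_measure_le_sum (disp : measure_display) (T : measurableType disp)
    (R : realType) (P : probability T R) (I : eqType) (s : seq I)
    (F : I -> set T) (A N : set T) :
  measurable A -> (forall i, measurable (F i)) ->
  measurable N -> P N = 0%E ->
  (forall t, A t -> N t \/ exists2 i, i \in s & F i t) ->
  fine (P A) <= \sum_(i <- s) fine (P (F i)).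
Proof.
move=> mA mF mN N0; elim: s A mA => [|i s IH] A mA sub.
  rewrite big_nil -[0]/(fine 0%E) -N0; apply: fine_le.
  - exact: fin_num_measure.
  - exact: fin_num_measure.
  - by apply: le_measure; rewrite ?inE// => t /sub[//|[]].
have mD : measurable (A `\` F i) by exact: measurableD.
have mI : measurable (A `&` F i) by exact: measurableI.
rewrite big_cons (measureDI _ mA (mF i)) fineD ?fin_num_measure// addrC.
apply: lerD.
  by apply: fine_le; rewrite ?fin_num_measure// le_measure ?inE//; exact: subIsetr.
apply: IH => // t [/sub[|[j]]]; first by left.
by rewrite inE => /predU1P[->//|js] Fj _; right; exists j.
Qed.

Lemma fine_probability_eq0 (disp : measure_display) (T : measurableType disp)
    (R : realType) (P : probability T R) (A : set T) :
  measurable A -> P A = 1%E -> P (~` A) = 0%E.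
Proof. by move=> mA PA; rewrite probability_setC// PA subee. Qed.

(** * Exponential tail bounds for the walk *)

Section Walk.
Variables (R : realType) (d : nat) (hd : (0 < d)%N) (beta mu : R).
Variables (disp : measure_display) (T : measurableType disp).
Variables (P : probability T R) (omega : nat -> T -> 'rV[int]_d).
Hypothesis walk : is_ERWD P beta mu omega.

Let X n t : R := (coord0 hd (omega n t))%:~R.

Lemma measurable_coord0 (n : nat) (B : set R) : measurable [set t | B (X n t)].
Proof.
exact: (@measurable_countable_preimage _ _ _ (omega n)
  [set x | B (coord0 hd x)%:~R] (ERWD_measurable walk n)).
Qed.

Lemma measurable_history (eta : nat -> 'rV[int]_d) (i : nat) :
  measurable (history omega eta i).
Proof.
rewrite (_ : history _ _ _ = \bigcap_(j in [set j | (j <= i)%N]) [set t | omega j t = eta j]).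
  by apply: bigcap_measurableType => j _; exact: (ERWD_measurable walk).
by [].
Qed.

Lemma measurable_step (n : nat) (A : set 'rV[int]_d) :
  measurable [set t | A (omega n.+1 t - omega n t)].
Proof.
apply: (@measurable_countable_preimage _ _ _ (fun t => (omega n.+1 t, omega n t))
  [set p | A (p.1 - p.2)]) => -[x y].
rewrite (_ : [set _ | _] = [set t | omega n.+1 t = x] `&` [set t | omega n t = y]).
  by apply: measurableI; exact: (ERWD_measurable walk).
by apply/seteqP; split => t /= [-> ->].
Qed.

Lemma history_ext (eta : nat -> 'rV[int]_d) (i : nat) (x : 'rV[int]_d) :
  history omega (ext eta i x) i.+1 =
  [set t | omega i.+1 t = eta i + x] `&` history omega eta i.
Proof.
apply/seteqP; split => t /=.
  move=> h; split => [|j ji]; first by rewrite h// ext_last.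
  by rewrite h ?ext_init// ltnW.
move=> [hi h] j; rewrite leq_eqVlt ltnS => /predU1P[->|ji].
  by rewrite hi ext_last.
by rewrite h// ext_init.
Qed.

Lemma fine_history_ext (eta : nat -> 'rV[int]_d) (i : nat) (a : dir d) :
  P (history omega eta i) != 0%E ->
  fine (P (history omega (ext eta i (vec a)) i.+1)) =
  fine (P (history omega eta i)) * step_prob beta mu eta i (vec a).
Proof.
move=> H0; have := ERWD_step walk (unit_vec_vec a) H0.
rewrite /cond_prob -history_ext => <-.
rewrite mulrC divfK// fine_eq0// fin_num_measure//.
exact: measurable_history.
Qed.

(** Outside a null set the next step is a unit vector, so the one-step extensions of the history
    cover the event. *)
Lemma history_split (eta : nat -> 'rV[int]_d) (i : nat) (A : set T) :
  measurable A ->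
  fine (P (history omega eta i `&` A)) <=
  \sum_(a : dir d) fine (P (history omega (ext eta i (vec a)) i.+1 `&` A)).
Proof.
move=> mA; have mstep := measurable_step i [set x | unit_vec x].
apply: (@fine_measure_le_sum _ _ _ P _ _ _ _
  (~` [set t | unit_vec (omega i.+1 t - omega i t)])).
- by apply: measurableI => //; exact: measurable_history.
- by move=> a; apply: measurableI => //; exact: measurable_history.
- exact: measurableC.
- exact/fine_probability_eq0/(ERWD_nearest_neighbour walk).
move=> t [Ht At].
have [/unit_vecP[a ha]|nn] := boolP (unit_vec (omega i.+1 t - omega i t)); last first.
  by left; exact/negP.
right; exists a; first exact: mem_index_enum.
split => //; rewrite history_ext; split => //=.
by rewrite -ha (Ht i)// addrC subrK.
Qed.

(** An exponential Markov inequality, proved by induction on the number [k] of remaining steps over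
    finite histories, so that no conditional expectation is needed. For [k = 0] the position is
    fixed by the history: either it is at least [c] and [expR (theta (X - c)) >= 1], or the event is
    empty. Histories end at time [i.+1] because the contraction needs a previous position. *)
Lemma tail_bound (theta kappa rho c : R) :
  0 <= beta -> beta <= 1 -> 0 <= mu -> mu <= 1 ->
  0 <= theta -> 0 <= kappa -> 0 <= rho ->
  (forall eta i, unit_vec (eta i.+1 - eta i) ->
    \sum_(a : dir d) step_prob beta mu eta i.+1 (vec a) *
       potential hd theta kappa (ext eta i.+1 (vec a)) i.+2
    <= rho * potential hd theta kappa eta i.+1) ->
  forall k eta i, unit_vec (eta i.+1 - eta i) ->
  fine (P (history omega eta i.+1 `&` [set t | c <= X (i.+1 + k) t])) <=
  fine (P (history omega eta i.+1)) *
    (expR (- (theta * c)) * rho ^+ k * potential hd theta kappa eta i.+1).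
Proof.
move=> b0 b1 m0 m1 t0 k0 r0 contr.
have mA n : measurable [set t | c <= X n t].
  exact: (measurable_coord0 n [set x | c <= x]).
elim=> [|k IH] eta i step.
  have mH := measurable_history eta i.+1.
  have [ceta|ceta] := leP c (coord0 hd (eta i.+1))%:~R.
    apply: (@le_trans _ _ (fine (P (history omega eta i.+1)))).
      apply: fine_le; rewrite ?fin_num_measure//; first exact: measurableI.
      by rewrite le_measure ?inE//; exact: measurableI.
    rewrite ler_peMr ?fine_ge0// expr0 mulr1.
    apply: (@le_trans _ _ (expR (- (theta * c)) * expR (theta * (coord0 hd (eta i.+1))%:~R))).
      by rewrite -expRD -mulrN -mulrDr -[leLHS]expR0 ler_expR mulr_ge0// addrC subr_ge0.
    by rewrite ler_wpM2l ?expR_ge0// le_potential.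
  rewrite (_ : _ `&` _ = set0).
    rewrite measure0 mulr_ge0 ?fine_ge0//; apply: mulr_ge0; last exact: potential_ge0.
    by rewrite mulr_ge0 ?expR_ge0 ?exprn_ge0.
  apply/seteqP; split => // t /= [Ht]; rewrite /X addn0 (Ht i.+1)//.
  by move=> /(lt_le_trans ceta); rewrite ltxx.
have mH := measurable_history eta i.+1.
(* The step law says nothing about a null history, but then both sides vanish. *)
have [H0|H0] := eqVneq (P (history omega eta i.+1)) 0%E.
  rewrite H0 mul0r -[leRHS]/(fine 0%E) -H0.
  apply: fine_le; rewrite ?fin_num_measure//; first exact: measurableI.
  by rewrite le_measure ?inE//; exact: measurableI.
apply: le_trans (history_split _ _ (mA _)) _.
set p := fine (P (history omega eta i.+1)).
apply: (@le_trans _ _ (\sum_(a : dir d) p * (expR (- (theta * c)) * rho ^+ k) *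
   (step_prob beta mu eta i.+1 (vec a) *
     potential hd theta kappa (ext eta i.+1 (vec a)) i.+2))).
  apply: ler_sum => a _; rewrite addnS -addSn.
  apply: le_trans (IH _ _ _) _.
    by rewrite ext_last ext_init// addrC addKr unit_vec_vec.
  rewrite fine_history_ext// -/p le_eqVlt; apply/orP; left; apply/eqP; ring.
rewrite -mulr_sumr exprSr [leRHS](_ : _ = p * (expR (- (theta * c)) * rho ^+ k) *
  (rho * potential hd theta kappa eta i.+1)); last by ring.
by rewrite ler_wpM2l ?contr// !mulr_ge0 ?fine_ge0 ?expR_ge0 ?exprn_ge0.
Qed.

(** The first step has no site to go back to, so it is treated crudely: each of the [2d] first steps
    gets probability at most 1 and potential at most [2 expR theta]. *)
Lemma tail_bound_start (theta kappa rho c : R) :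
  0 <= beta -> beta <= 1 -> 0 <= mu -> mu <= 1 ->
  0 <= theta -> 0 <= kappa -> kappa <= 1 -> 0 <= rho ->
  (forall eta i, unit_vec (eta i.+1 - eta i) ->
    \sum_(a : dir d) step_prob beta mu eta i.+1 (vec a) *
       potential hd theta kappa (ext eta i.+1 (vec a)) i.+2
    <= rho * potential hd theta kappa eta i.+1) ->
  forall k, fine (P [set t | c <= X k.+1 t]) <=
  (#|dir d|)%:R * (expR (- (theta * c)) * rho ^+ k * (2 * expR theta)).
Proof.
move=> b0 b1 m0 m1 t0 k0 k1 r0 contr k.
have mA : measurable [set t | c <= X k.+1 t].
  exact: (measurable_coord0 k.+1 [set x | c <= x]).
(* Only [z 0] matters: the history of [z] at time 0 is the almost sure event that the walk starts at
   the origin. *)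
pose z (j : nat) : 'rV[int]_d := 0.
have mH := measurable_history z 0.
have H0 : P (~` history omega z 0) = 0%E.
  apply: fine_probability_eq0 => //; rewrite -(ERWD_start walk); congr (P _).
  apply/seteqP; split => t /=; first by move=> /(_ 0%N) ->.
  by move=> t0' j; rewrite leqn0 => /eqP ->.
have AH : fine (P [set t | c <= X k.+1 t]) <=
    fine (P (history omega z 0 `&` [set t | c <= X k.+1 t])).
  (* A union bound with a single set, used to discard the null set. *)
  rewrite [leRHS](_ : _ = \sum_(i <- [:: tt])
      fine (P (history omega z 0 `&` [set t | c <= X k.+1 t]))); last by rewrite big_seq1.
  apply: (@fine_measure_le_sum _ _ _ P _ _ _ _ (~` history omega z 0)) => //.
  - by move=> _; exact: measurableI.
  - exact: measurableC.
  move=> t At; have [Ht|Ht] := pselect (history omega z 0 t); last by left.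
  by right; exists tt; rewrite ?inE.
apply: (le_trans AH); apply: le_trans (history_split _ _ mA) _.
rewrite [leRHS](_ : _ = \sum_(a : dir d) (expR (- (theta * c)) * rho ^+ k * (2 * expR theta)));
  last by rewrite sumr_const [in LHS]mulr_natl.
apply: ler_sum => a _.
have step : unit_vec (ext z 0 (vec a) 1 - ext z 0 (vec a) 0).
  by rewrite ext_last ext_init// addrC addKr unit_vec_vec.
have := tail_bound c b0 b1 m0 m1 t0 k0 r0 contr k step.
rewrite add1n => /le_trans; apply.
have C0 : 0 <= expR (- (theta * c)) * rho ^+ k by rewrite mulr_ge0 ?expR_ge0 ?exprn_ge0.
apply: (@le_trans _ _ (1 * (expR (- (theta * c)) * rho ^+ k * (2 * expR theta)))); last by rewrite mul1r.
apply: ler_pM.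
- exact: fine_ge0.
- by apply: mulr_ge0 => //; exact: potential_ge0.
- rewrite -[leRHS]/(fine 1%E); apply: fine_le; rewrite ?fin_num_measure//.
    exact: measurable_history.
  by rewrite probability_le1//; exact: measurable_history.
rewrite ler_wpM2l//; apply: le_trans (potential_le _ _ _ _ _) _ => //.
rewrite mulrC; apply: ler_pM; rewrite ?expR_ge0 ?addr_ge0//; first lra.
rewrite ler_expR coord0_ext /coord0 mxE add0r.
by rewrite -[leRHS]mulr1 ler_wpM2l//; case: (dx_cases R hd a) => ->; lra.
Qed.

End Walk.

(** * Summability, Borel-Cantelli and the speed *)

Lemma nneseries_geometric_lty (R : realType) (u : nat -> R) (C q : R) :
  0 <= C -> 0 < q -> q < 1 -> (forall n, 0 <= u n) -> (forall n, u n <= C * q ^+ n) ->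
  (\sum_(n <oo) (u n)%:E < +oo)%E.
Proof.
move=> C0 q0 q1 u0 uC.
apply: (@le_lt_trans _ _ (C * (1 - q)^-1)%:E); last exact: ltry.
apply: lime_le.
  by apply: is_cvg_nneseries => n _ _; rewrite lee_fin.
apply: nearW => n; rewrite sumEFin lee_fin.
apply: (@le_trans _ _ (series (geometric C q) n)).
  by apply: ler_sum => i _; exact: uC.
by apply: geometric_le_lim => //; rewrite gtr0_norm.
Qed.

Lemma limn_esup_le_near (R : realType) (u : nat -> \bar R) (l : \bar R) (N : nat) :
  (forall n, (N <= n)%N -> (u n <= l)%E) -> (limn_esup u <= l)%E.
Proof.
move=> ul; rewrite /limn_esup limf_esupE.
apply: (@le_trans _ _ (ereal_sup (u @` [set n | (N <= n)%N]))).
  by apply: ereal_inf_lbound; exists [set n | (N <= n)%N] => //; exists N.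
by apply: ge_ereal_sup => _ [n /= Nn <-]; exact: ul.
Qed.

Theorem lemma1p3 (R : realType) (d : nat) (hd : (1 < d)%N) (mu : R)
    (mu_gt0 : 0 < mu) (mu_le1 : mu <= 1) :
  exists delta : R, 0 < delta /\
  exists beta_star : R, 0 < beta_star /\
  forall beta : R, 0 <= beta -> beta <= 1 -> beta < beta_star ->
  forall (disp : measure_display) (T : measurableType disp)
    (P : probability T R) (omega : nat -> T -> 'rV[int]_d),
  is_ERWD P beta mu omega ->
  P [set t | (limn_esup (fun n : nat =>
       ((omega n t ord0 (Ordinal (ltnW hd)))%:~R / n%:R : R)%:E)
       < (- delta)%:E)%E] = 1%E.
Proof.
have d_gt0 : 0 < d%:R :> R by rewrite ltr0n (ltnW hd).
have [u [uE u0 u1]] : exists u : R, [/\ u = d%:R^-1, 0 < u & u <= 1].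
  by exists d%:R^-1; rewrite invr_gt0 d_gt0 invf_le1// ler1n (ltnW hd).
have [theta [t0 t256]] : exists theta : R, 0 < theta /\ 16 * (16 * theta) <= mu * u.
  exists (mu * u / 16 / 16); split; last by lra.
  by rewrite !divr_gt0 ?mulr_gt0.
(* With [delta = theta u], the Markov factor at level [- 2 delta n] is [expR (2 theta^2 u n)], which
   grows at half the rate at which the powers of [rho = 1 - 4 theta^2 u] decay, or slower. *)
exists (theta * u); split; first exact: mulr_gt0.
(* This keeps the rightward drift term [beta theta u] within the second-order term [2 theta^2 u]. *)
exists (2 * theta); split; first exact: mulr_gt0.
move=> beta b0 b1 bt disp T P omega walk.
have [] := contraction_constants mu_gt0 mu_le1 u0 u1 t0 t256 (ltW bt).
set kappa := theta * mu * u / 2; set rho := 1 - 4 * theta ^+ 2 * u.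
move=> t32 k1 hvis hnew; rewrite uE in hvis hnew.
have k0 : 0 <= kappa by rewrite /kappa divr_ge0// !mulr_ge0// ltW.
have tu0 : 0 < theta ^+ 2 * u by rewrite mulr_gt0// exprn_gt0.
have rho0 : 0 <= rho.
  have : theta ^+ 2 * u <= 32^-1.
    rewrite -[leRHS]mulr1; apply: ler_pM => //; rewrite ?sqr_ge0 ?(ltW u0)//.
    rewrite -[leRHS]mulr1; apply: ler_pM; rewrite ?(ltW t0)//; lra.
  by rewrite /rho; lra.
have beta_small : beta <= 2^-1 by lra.
have theta_small : theta <= 2^-1 by lra.
have contr eta i := @potential_step R d (ltnW hd) beta mu theta kappa rho eta i b0
  beta_small (ltW mu_gt0) mu_le1 (ltW t0) theta_small k0 hvis hnew.
pose X n t : R := (coord0 (ltnW hd) (omega n t))%:~R.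
(* [F k] concerns time [k.+1], as the tail bound does; this also avoids dividing by time 0. *)
pose F k := [set t | - (2 * theta * u) * k.+1%:R <= X k.+1 t].
pose q := expR (- (2 * theta ^+ 2 * u)).
pose C := (#|dir d|)%:R * (expR (2 * theta ^+ 2 * u) * (2 * expR theta)).
have mF k : measurable (F k).
  exact: (measurable_coord0 (ltnW hd) walk k.+1 [set x | _ <= x]).
have PF k : fine (P (F k)) <= C * q ^+ k.
  apply: le_trans (tail_bound_start walk (- (2 * theta * u) * k.+1%:R) b0 b1
    (ltW mu_gt0) mu_le1 (ltW t0) k0 k1 rho0 contr k) _.
  (* The exponent is [(k + 1) s]: one [s] goes into [C], and the others are absorbed by the powers
     of [rho]. *)
  set s := 2 * theta ^+ 2 * u in q C *.
  rewrite (_ : - (theta * _) = s + k%:R * s); last by rewrite /s -natr1; ring.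
  (* Since [rho = 1 - 2 s <= expR (- (2 s))], the product is at most [expR (- s)]. *)
  have rho_q : expR s * rho <= q.
    rewrite (_ : q = expR s * expR (- (2 * s))); last by rewrite -expRD; congr expR; ring.
    rewrite ler_wpM2l ?expR_ge0//; apply: le_trans (expR_ge1Dx _).
    by rewrite /rho /s; lra.
  rewrite expRD expRM_natl -!mulrA [_ ^+ k * (rho ^+ k * _)]mulrA -exprMn.
  rewrite [leRHS](_ : _ = #|dir d|%:R * (expR s * (q ^+ k * (2 * expR theta)))); last by rewrite /C; ring.
  rewrite ler_wpM2l// ler_wpM2l ?expR_ge0// ler_wpM2r ?mulr_ge0 ?expR_ge0//.
  by rewrite lerXn2r ?nnegrE ?mulr_ge0 ?expR_ge0.
have PF0 : P (lim_sup_set F) = 0%E.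
  apply: lim_sup_set_cvg0 => //.
  rewrite (eq_eseriesr (g := fun k => (fine (P (F k)))%:E)); last first.
    by move=> k _; rewrite fineK// fin_num_measure.
  apply: (@nneseries_geometric_lty _ _ C q) => //.
  - by rewrite !mulr_ge0 ?expR_ge0.
  - exact: expR_gt0.
  - by rewrite expR_lt1 oppr_lt0 -mulrA mulr_gt0.
  - by move=> n; exact: fine_ge0.
pose L t := limn_esup (fun n =>
  ((omega n t ord0 (Ordinal (ltnW hd)))%:~R / n%:R : R)%:E).
pose E := [set t | (L t < (- (theta * u))%:E)%E].
change (P E = 1%E).
have mE : measurable E.
  rewrite /E -[X in measurable X]setTI.
  apply: (@measurable_fun_limn_esup _ _ _ setT _ _ measurableT
    [set x | (x < (- (theta * u))%:E)%E] _); last first.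
    by rewrite -set_itvNyo; exact: emeasurable_itv.
  move=> n _ B _; rewrite setTI.
  exact: (@measurable_countable_preimage _ _ _ (omega n)
    [set x | B ((x ord0 (Ordinal (ltnW hd)))%:~R / n%:R)%:E] (ERWD_measurable walk n)).
have mS : measurable (lim_sup_set F).
  apply: bigcap_measurable => // n _; apply: bigcup_measurable => k _; exact: mF.
apply/eqP; rewrite eq_le probability_le1//=.
(* It suffices that [E] contains the almost sure event that only finitely many [F k] occur. *)
apply: (@le_trans _ _ (P (~` lim_sup_set F))).
  by rewrite probability_setC// PF0 sube0.
apply: le_measure; rewrite ?inE//; first exact: measurableC.
move=> t nFt.
have [N hN] : exists N, forall k, (N <= k)%N -> ~ F k t.
  apply: contrapT => h; apply: nFt => N _; apply: contrapT => hN; apply: h.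
  by exists N => k Nk Fkt; apply: hN; exists k.
(* The bounds at finite times give only a weak inequality for the upper limit; the factor 2 in [F]
   restores strictness. *)
apply: (@le_lt_trans _ _ (- (2 * theta * u))%:E).
  apply: (@limn_esup_le_near _ _ _ N.+1) => -[//|k] Nk.
  rewrite lee_fin ler_pdivrMr ?ltr0n//; apply: ltW; rewrite ltNge.
  by apply/negP; exact: hN.
by rewrite lte_fin ltrN2 -mulrA ltr_pMl ?mulr_gt0// ltr1n.
Qed.
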